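(* Let $G=(V,E)$ be a connected graph of order $n$, let $X$ be a nonempty proper subset of $V$, and let $\phi$ be a real number with $a(G)\le \phi\le \mu_1$. Then $$S_L(G)\ \ge\ |\phi-\rho_G(X)|.$$ If equality holds, then there are integers $s$ and $t$ such that (1) each vertex in $X$ is adjacent to exactly $s$ vertices in $X^c$ and each vertex in $X^c$ is adjacent to exactly $t$ vertices in $X$, and (2) $s|X|=t|X^c|$. Moreover, if equality holds, then $\{\rho_G(X),\phi\}=\{\mu_1,a(G)\}$.
   Context: Graphs are finite, simple and undirected. For a graph $G$ with $n$ vertices, $L(G)=D(G)-A(G)$ is the Laplacian matrix (degree matrix minus adjacency matrix), with eigenvalues $\mu_1\ge\dots\ge\mu_{n-1}\ge\mu_n=0$. The algebraic connectivity is $a(G)=\mu_{n-1}$ and the Laplacian spread is $S_L(G)=\mu_1-a(G)$. For a nonempty proper subset $X$ of $V(G)$, $X^c=V(G)\setminus X$, $E_X(G)$ is the set of edges with one end in $X$ and the other in $X^c$, and the edge density of $X$ is $\rho_G(X)=\dfrac{n|E_X(G)|}{|X||X^c|}$. *)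

(* Defs.v *)
From mathcomp Require Import all_boot all_order all_algebra.
From mathcomp Require Import polyrcf.
From mathcomp Require Import reals.

Set Implicit Arguments.
Unset Strict Implicit.
Unset Printing Implicit Defensive.

Import Order.TTheory GRing.Theory Num.Theory.

Local Open Scope ring_scope.

(* A finite simple graph is a symmetric irreflexive relation on a finType;   *)
(* matrices are indexed by the vertices through [enum_val].                  *)

Definition adjacency_mx (R : rcfType) (T : finType) (e : rel T) : 'M[R]_#|T| :=
  \matrix_(i, j) (e (enum_val i) (enum_val j))%:R.

Definition degree (T : finType) (e : rel T) (x : T) : nat :=
  #|[set y | e x y]|.

Definition degree_mx (R : rcfType) (T : finType) (e : rel T) : 'M[R]_#|T| :=
  diag_mx (\row_i (degree e (enum_val i))%:R).

Definition laplacian (R : rcfType) (T : finType) (e : rel T) : 'M[R]_#|T| :=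
  degree_mx R e - adjacency_mx R e.

(* The real eigenvalues of A, repeated according to their multiplicity as    *)
(* roots of the characteristic polynomial, in nonincreasing order.  When A   *)
(* is symmetric all its eigenvalues are real, so this sequence has size n.   *)
Definition spectrum (R : rcfType) (n : nat) (A : 'M[R]_n) : seq R :=
  sort >=%R
    (flatten [seq nseq (mup x (char_poly A)) x | x <- rootsR (char_poly A)]).

(* Eigenvalues are numbered from 1: mu_1 >= ... >= mu_n. *)
Definition laplacian_mu (R : rcfType) (T : finType) (e : rel T) (k : nat) : R :=
  nth 0 (spectrum (laplacian R e)) k.-1.

Definition algebraic_connectivity (R : rcfType) (T : finType) (e : rel T) : R :=
  laplacian_mu R e #|T|.-1.

Definition laplacian_spread (R : rcfType) (T : finType) (e : rel T) : R :=
  laplacian_mu R e 1 - algebraic_connectivity R e.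

Definition connected_graph (T : finType) (e : rel T) : Prop :=
  forall x y : T, connect e x y.

(* Edges are unordered pairs {x, y}. *)
Definition edge_cut (T : finType) (e : rel T) (X : {set T}) : {set {set T}} :=
  [set [set x; y] | x in X, y in ~: X & e x y].

Definition edge_density (R : rcfType) (T : finType) (e : rel T) (X : {set T}) : R :=
  (#|T|%:R * #|edge_cut e X|%:R) / (#|X|%:R * #|~: X|%:R).

(* Main.v *)
Require Import Defs.
From mathcomp Require Import all_boot all_order all_algebra.
From mathcomp Require Import polyrcf complex.
From mathcomp Require Import reals zify ring lra.

(** The edge density of X is a Rayleigh quotient of the Laplacian L.  Take the
cut vector f, equal to |X^c| on X and to -|X| on X^c: it is orthogonal to the
constant vector 1, it satisfies f f^T = n |X| |X^c|, and f L f^T = n^2 |E_X|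
because two adjacent vertices have f-values that differ by 0 or n.  Hence
f L f^T = rho(X) f f^T ([cut_rayleigh]).

L is symmetric and positive semidefinite and kills the constants, so the
variational description of its extreme eigenvalues gives a <= rho(X) <= mu_1
([edge_density_ge], [edge_density_le]).  As phi lies in the same interval
[a, mu_1], its distance to rho(X) is at most the length of that interval; in
case of equality rho(X) and phi are its two end points.

When rho(X) is an end point, f attains an extremal Rayleigh quotient and is
therefore an eigenvector.  Reading f L = rho(X) f at a vertex of X, where the
left side is n times its number of neighbours in X^c, shows that this number is
the same for all vertices of X; likewise on the other side
([cut_eigenvector_biregular]).  Counting the cut edges from both sides gives
s |X| = t |X^c|.

The variational facts ([rayleigh_max], [rayleigh_second]) come from a unitary
diagonalisation of L over the complex field R[i]: its eigenvalues are real, and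
with multiplicity they are the entries of the sorted list [spectrum L]. *)

Set Implicit Arguments.
Unset Strict Implicit.
Unset Printing Implicit Defensive.

Import Order.TTheory GRing.Theory Num.Theory.

Local Open Scope ring_scope.
Local Open Scope sesquilinear_scope.

Local Notation toC := (map_mx (real_complex _)).

(** * Spectral decomposition and the sorted spectrum *)

Lemma char_poly_similar (F : fieldType) n (P A B : 'M[F]_n) :
  P \in unitmx -> P *m A = B *m P -> char_poly A = char_poly B.
Proof.
move=> Punit PA.
pose Q := map_mx polyC P.
have QA : Q *m char_poly_mx A = char_poly_mx B *m Q.
  rewrite /char_poly_mx mulmxBr mulmxBl -!map_mxM PA.
  by rewrite scalar_mxC.
have Q0 : \det Q != 0.
  by rewrite det_map_mx polyC_eq0 -unitfE -unitmxE.
apply: (mulfI Q0).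
by rewrite /char_poly -det_mulmx QA det_mulmx mulrC.
Qed.

(** A real symmetric matrix is Hermitian over R[i], where the spectral theorem
provides a unitary P and real eigenvalues.  Only P is complex, so the
characteristic polynomial already splits over R. *)
Lemma symmetric_spectral (R : rcfType) n (A : 'M[R]_n) : A^T = A ->
  exists (P : 'M[R[i]]_n) (d : 'rV[R]_n),
    [/\ P \is unitarymx, P *m toC A = diag_mx (toC d) *m P
      & char_poly A = \prod_i ('X - (d 0 i)%:P)].
Proof.
move=> Asym.
have Aherm : toC A \is hermsymmx.
  apply: realsym_hermsym.
    apply/is_hermitianmxP; rewrite expr0 scale1r map_mx_id //.
    by rewrite map_trmx Asym.
  by apply/mxOverP => i j; rewrite mxE; apply/complex_realP; exists (A i j).
have dreal := hermitian_spectral_diag_real Aherm.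
have Aspec := orthomx_spectralP (hermitian_normalmx Aherm).
set P := spectralmx (toC A) in Aspec *.
set D := spectral_diag (toC A) in Aspec dreal *.
have Punit : P \in unitmx := spectral_unit _.
pose d : 'rV[R]_n := map_mx (@complex.Re R) D.
have DE : toC d = D.
  by apply/rowP => i; rewrite !mxE RRe_real // (mxOverP dreal).
have PA : P *m toC A = diag_mx (toC d) *m P.
  by rewrite {1}Aspec DE !mulmxA mulmxV // mul1mx.
exists P, d; split; rewrite ?spectral_unitarymx //.
apply: (map_poly_inj (real_complex R)).
rewrite map_char_poly (char_poly_similar Punit PA).
rewrite char_poly_trig ?diag_mx_is_trig // rmorph_prod.
by apply: eq_bigr => i _; rewrite !mxE eqxx mulr1n -map_polyXsubC.
Qed.

Lemma count_mem_spectrum (R : rcfType) n (A : 'M[R]_n) x :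
  count_mem x (spectrum A) = mup x (char_poly A).
Proof.
have cp0 : char_poly A != 0 by rewrite monic_neq0 ?char_poly_monic.
rewrite /spectrum count_sort count_flatten -map_comp.
under eq_map => y do rewrite /= count_nseq /=.
rewrite sumnE big_map.
have [xr|xNr] := boolP (x \in rootsR (char_poly A)).
  rewrite (bigD1_seq x) ?uniq_roots //= eqxx mul1n big1 ?addn0 // => y /negPf.
  by rewrite eq_sym => ->.
rewrite big_seq big1 => [|y yr]; last first.
  by case: eqVneq yr xNr => // -> ->.
by rewrite mupNroot // -[root _ _]/(true && _) roots_on_rootsR.
Qed.

Lemma mup_prod_XsubC (R : fieldType) (s : seq R) x :
  mup x (\prod_(y <- s) ('X - y%:P)) = count_mem x s.
Proof.
elim: s => [|y s IHs]; first by rewrite big_nil mupNroot ?root1.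
rewrite big_cons mupM ?polyXsubC_eq0 ?monic_neq0 ?monic_prod_XsubC //.
by rewrite IHs -['X - y%:P]expr1 mup_XsubCX /= eq_sym; case: eqP.
Qed.

Lemma perm_spectrum (R : rcfType) n (A : 'M[R]_n) (d : 'rV[R]_n) :
  char_poly A = \prod_i ('X - (d 0 i)%:P) ->
  perm_eq (spectrum A) [seq d 0 i | i : 'I_n].
Proof.
move=> Ad; apply/allP => x _ /=; apply/eqP.
by rewrite count_mem_spectrum Ad -mup_prod_XsubC big_map big_enum.
Qed.

Lemma spectrum_sorted (R : rcfType) n (A : 'M[R]_n) : sorted >=%R (spectrum A).
Proof. by apply: sort_sorted => x y; apply: le_total. Qed.

(** In a nonincreasing list the items strictly below the k-th one can only come
after position k. *)
Lemma count_lt_nth (R : realDomainType) (x0 : R) (s : seq R) k :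
  sorted >=%R s -> (k < size s)%N ->
  (count (fun x => x < nth x0 s k)%R s <= size s - k.+1)%N.
Proof.
move=> s_sorted ks.
rewrite -[X in count _ X](cat_take_drop k.+1) count_cat -[leqRHS]add0n leq_add //.
  rewrite leqNgt -has_count; apply/hasPn => y /(nthP x0)[j].
  rewrite size_take_min leq_min => /andP[jk js] <-; rewrite nth_take // -leNgt.
  by apply: (sorted_leq_nth ge_trans lexx).
by rewrite (leq_trans (count_size _ _)) // size_drop.
Qed.

(** * Quadratic forms in spectral coordinates *)

Section Coordinates.

Variables (R : rcfType) (n : nat) (P : 'M[R[i]]_n) (B : 'M[R]_n) (d : 'rV[R]_n).
Hypotheses (Punitary : P \is unitarymx)
           (PB : P *m toC B = diag_mx (toC d) *m P).

(** The rows of P are orthonormal eigenvectors of B; these are the components of f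
along them. *)
Definition coords (f : 'rV[R]_n) : 'rV[R[i]]_n := toC f *m P^t*.

Lemma coords_mul f : toC (f *m B) = coords f *m diag_mx (toC d) *m P.
Proof.
have PtP : P^t* *m P = 1%:M by apply/mulmx1C/unitarymxP.
by rewrite map_mxM /coords -!mulmxA -PB [P^t* *m _]mulmxA PtP mul1mx.
Qed.

Lemma coords_form f g :
  ((f *m B *m g^T) 0 0)%:C%C
  = \sum_i (d 0 i)%:C%C * (coords f 0 i * Num.conj (coords g 0 i)).
Proof.
transitivity (toC (f *m B *m g^T) 0 0); first by rewrite [RHS]mxE.
rewrite map_mxM coords_mul -mulmxA.
have -> : P *m toC g^T = (coords g)^t*.
  rewrite /coords trmx_mul map_mxM !map_trmx trmxK -!map_mx_comp.
  congr (_ *m _); apply/matrixP => i j; rewrite !mxE /= ?conjCK //.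
  exact: esym (conjc_real _).
rewrite mul_mx_diag mxE; apply: eq_bigr => i _.
by rewrite mxE [toC d 0 i]mxE [_^t* i 0]mxE [_^T i 0]mxE mulrAC mulrC.
Qed.

Lemma coords_inj f : coords f = 0 -> f = 0.
Proof.
rewrite /coords => /(congr1 (mulmx^~ P)); rewrite -mulmxA mul0mx.
have -> : P^t* *m P = 1%:M by apply/mulmx1C/unitarymxP.
by rewrite mulmx1 -[RHS](map_mx0 (real_complex R)); apply: map_mx_inj.
Qed.

Lemma coords_kernel f i : f *m B = 0 -> d 0 i != 0 -> coords f 0 i = 0.
Proof.
move=> fB0 di0; have := coords_mul f; rewrite fB0 map_mx0 => /esym.
move=> /(congr1 (mulmx^~ (P^t*))); rewrite mulmxtVK // mul0mx.
rewrite mul_mx_diag => /rowP/(_ i).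
rewrite mxE [RHS]mxE [toC d 0 i]mxE => /eqP; rewrite mulf_eq0 => /orP[/eqP//|].
by rewrite -(rmorph0 (real_complex R)) (inj_eq (@complexI R)) (negPf di0).
Qed.

(** The form is the sum of the d_i |c_i|^2, where c_i are the coordinates of f.
Negative eigenvalues are tolerated in directions orthogonal to f: this is what
allows the smallest eigenvalue to be skipped in [rayleigh_second]. *)
Lemma form_ge0 f :
  (forall i, 0 <= d 0 i \/ coords f 0 i = 0) ->
  0 <= (f *m B *m f^T) 0 0 /\ ((f *m B *m f^T) 0 0 = 0 -> f *m B = 0).
Proof.
move=> d_ge0.
have formE := coords_form f f.
have term_ge0 i :
  0 <= (d 0 i)%:C%C * (coords f 0 i * Num.conj (coords f 0 i)).
  rewrite -normCK.
  case: (d_ge0 i) => [di|->]; last by rewrite normr0 expr0n mulr0.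
  by rewrite mulr_ge0 ?ler0c ?exprn_ge0.
split; first by rewrite -ler0c formE sumr_ge0.
move=> form0; apply: (map_mx_inj (f := real_complex R)).
rewrite map_mx0 coords_mul.
have -> : coords f *m diag_mx (toC d) = 0; last by rewrite mul0mx.
move: formE; rewrite form0 => /esym /psumr_eq0P sum0.
apply/rowP => i; rewrite mul_mx_diag mxE [RHS]mxE [toC d 0 i]mxE.
have /eqP := sum0 (fun i _ => term_ge0 i) i isT.
rewrite -normCK mulf_eq0 expf_eq0 /= normr_eq0.
by case/orP => /eqP ->; rewrite ?mulr0 ?mul0r.
Qed.

End Coordinates.

(** Comparing the form of A with m times the norm amounts to the sign of the form
of m - A or A - m, which P diagonalises too. *)
Lemma diagonal_affine (R : rcfType) n (P : 'M[R[i]]_n) (A : 'M[R]_n)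
    (d : 'rV[R]_n) (a b : R) :
  P *m toC A = diag_mx (toC d) *m P ->
  P *m toC (a *: A + b%:M) = diag_mx (toC (a *: d + const_mx b)) *m P.
Proof.
move=> PA.
rewrite !map_mxD !map_mxZ map_scalar_mx map_const_mx.
rewrite [diag_mx _]linearD /= [diag_mx (_ *: _)]linearZ /= diag_const_mx.
by rewrite mulmxDr mulmxDl -scalemxAr -scalemxAl PA scalar_mxC.
Qed.

(** * Variational bounds for the extreme eigenvalues *)

Lemma rayleigh_max (R : rcfType) n (A : 'M[R]_n) (f : 'rV[R]_n)
    (m := nth 0 (spectrum A) 0) : A^T = A ->
  (f *m A *m f^T) 0 0 <= m * (f *m f^T) 0 0 /\
  ((f *m A *m f^T) 0 0 = m * (f *m f^T) 0 0 -> f *m A = m *: f).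
Proof.
move=> /symmetric_spectral[P [d [Pu PA Ad]]].
have d_le i : d 0 i <= m.
  have: d 0 i \in spectrum A by rewrite (perm_mem (perm_spectrum Ad)) image_f.
  move=> /(nthP 0)[k ks <-].
  apply: (sorted_leq_nth ge_trans lexx _ (spectrum_sorted A)) => //.
  exact: leq_ltn_trans ks.
have [|ge0 eq0] := form_ge0 Pu (diagonal_affine (-1) m PA) (f := f).
  by move=> i; left; rewrite !mxE mulN1r addrC subr_ge0.
have E : f *m (-1 *: A + m%:M) = m *: f - f *m A.
  by rewrite mulmxDr -scalemxAr mul_mx_scalar scaleN1r addrC.
have formE : ((m *: f - f *m A) *m f^T) 0 0
    = m * (f *m f^T) 0 0 - (f *m A *m f^T) 0 0.
  by rewrite mulmxBl -scalemxAl [LHS]mxE; congr (_ + _); rewrite [LHS]mxE.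
move: ge0 eq0; rewrite E formE.
rewrite subr_ge0 => le_form eq0; split=> // eq_form.
by apply/esym/eqP; rewrite -subr_eq0; apply/eqP/eq0; rewrite eq_form subrr.
Qed.

(** Courant-Fischer for the second smallest eigenvalue m of a positive
semidefinite matrix with a known kernel vector u.  If m <= 0, no eigenvalue lies
below m.  If m > 0, at most one index i has d_i < m; all other eigenvalues are
positive, so the kernel vector u is concentrated on i, and orthogonality to u
forces the i-th coordinate of f to vanish. *)
Lemma rayleigh_second (R : rcfType) n (A : 'M[R]_n) (u f : 'rV[R]_n)
    (m := nth 0 (spectrum A) n.-2) :
  (1 < n)%N -> A^T = A -> (forall v : 'rV[R]_n, 0 <= (v *m A *m v^T) 0 0) ->
  u != 0 -> u *m A = 0 -> (f *m u^T) 0 0 = 0 ->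
  m * (f *m f^T) 0 0 <= (f *m A *m f^T) 0 0 /\
  ((f *m A *m f^T) 0 0 = m * (f *m f^T) 0 0 -> f *m A = m *: f).
Proof.
move=> n_gt1 /symmetric_spectral[P [d [Pu PA Ad]]] psd u0 uA0 fu0.
have d_ge0 i : 0 <= d 0 i.
  have /eigenvalueP[v vA v0] : eigenvalue A (d 0 i).
    rewrite eigenvalue_root_char Ad rootE horner_prod (bigD1 i) //=.
    by rewrite !hornerE subrr mul0r.
  have := psd v; rewrite vA -scalemxAl mxE pmulr_lge0 //.
  have sq k : 0 <= v 0 k * v^T k 0 by rewrite [v^T _ _]mxE -expr2 sqr_ge0.
  rewrite lt_neqAle mxE sumr_ge0 // andbT eq_sym; apply: contra v0 => /eqP.
  move=> /psumr_eq0P v0; apply/eqP/rowP => k; rewrite [RHS]mxE.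
  have /eqP := v0 (fun k _ => sq k) k isT.
  by rewrite [v^T _ _]mxE mulf_eq0 orbb => /eqP.
(* Only one item follows position n - 2, so at most one index lies below m. *)
have le1 i j : d 0 i < m -> d 0 j < m -> i = j.
  have sz : size (spectrum A) = n.
    by rewrite (perm_size (perm_spectrum Ad)) size_map -cardE card_ord.
  have : (#|[pred i : 'I_n | (d 0 i < m)%R]| <= 1)%N.
    have := @count_lt_nth _ 0 (spectrum A) n.-2 (spectrum_sorted A).
    rewrite sz (permP (perm_spectrum Ad)) count_map enumT => H.
    by rewrite cardE /enum_mem size_filter; apply: leq_trans (H _) _; lia.
  by move=> /card_le1_eqP H im jm; apply: H.
have d_lt i : d 0 i < m -> coords P f 0 i = 0.
  move=> dim.
  have cu0 j : j != i -> coords P u 0 j = 0.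
    move=> ji; apply: (coords_kernel Pu PA uA0).
    have mj : m <= d 0 j by rewrite leNgt; apply: contra ji => /le1/(_ dim) ->.
    by rewrite gt_eqF // (lt_le_trans _ mj) // (le_lt_trans _ dim).
  have cui : coords P u 0 i != 0.
    apply: contra u0 => /eqP cui; apply/eqP/(coords_inj Pu)/rowP => j.
    by rewrite [RHS]mxE; have [->|/cu0] := eqVneq j i.
  (* Parseval: the spectral form of the identity matrix expresses f u^T. *)
  have P1 : P *m toC 1%:M = diag_mx (toC (const_mx 1)) *m P.
    by rewrite map_scalar_mx map_const_mx diag_const_mx scalar_mxC.
  have := coords_form Pu P1 f u; rewrite mulmx1 fu0 (bigD1 i) //= big1 => [|j ji].
    rewrite addr0 mxE rmorph1 mul1r rmorph0 => /esym/eqP.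
    by rewrite mulf_eq0 conjC_eq0 (negPf cui) orbF => /eqP.
  by rewrite cu0 // rmorph0 !mulr0.
have [|ge0 eq0] := form_ge0 Pu (diagonal_affine 1 (- m) PA) (f := f).
  move=> i; have [/d_lt|mi] := ltP (d 0 i) m; first by right.
  by left; rewrite !mxE mul1r subr_ge0.
have E : f *m (1 *: A + (- m)%:M) = f *m A - m *: f.
  by rewrite mulmxDr -scalemxAr mul_mx_scalar scale1r scaleNr.
have formE : ((f *m A - m *: f) *m f^T) 0 0
    = (f *m A *m f^T) 0 0 - m * (f *m f^T) 0 0.
  by rewrite mulmxBl -scalemxAl [LHS]mxE; congr (_ + _); rewrite !mxE.
move: ge0 eq0; rewrite E formE.
rewrite subr_ge0 => le_form eq0; split=> // eq_form.
by apply/eqP; rewrite -subr_eq0; apply/eqP/eq0; rewrite eq_form subrr.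
Qed.

(** * The Laplacian form and the cut vector *)

Section CutVector.

Variables (R : rcfType) (T : finType) (e : rel T).
Hypothesis e_sym : symmetric e.

Definition vertex_row (h : T -> R) : 'rV[R]_#|T| := \row_i h (enum_val i).

Lemma vertex_rowE (f : 'rV[R]_#|T|) : f = vertex_row (fun x => f 0 (enum_rank x)).
Proof. by apply/rowP => i; rewrite mxE enum_valK. Qed.

Lemma vertex_row_dot g h :
  (vertex_row g *m (vertex_row h)^T) 0 0 = \sum_x g x * h x.
Proof.
rewrite mxE (big_enum_val (A := T)) /=.
by apply: eq_bigr => i _; rewrite !mxE.
Qed.

Lemma laplacian_tr : (laplacian R e)^T = laplacian R e.
Proof.
rewrite /laplacian linearB /= tr_diag_mx; congr (_ - _).
by apply/matrixP => i j; rewrite !mxE e_sym.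
Qed.

Lemma laplacian_vertex_row h :
  vertex_row h *m laplacian R e
  = vertex_row (fun x => \sum_y (e x y)%:R * (h x - h y)).
Proof.
apply/rowP => j; rewrite mulmxBr mul_mx_diag !mxE.
under [RHS]eq_bigr do rewrite mulrBr.
rewrite sumrB; congr (_ - _).
  rewrite -mulr_suml mulrC /degree -sum1_card natr_sum; congr (_ * _).
  rewrite big_mkcond; apply: eq_bigr => y _; rewrite inE.
  by case: (e _ _).
rewrite (big_enum_val (A := T)) /=.
by apply: eq_bigr => i _; rewrite !mxE e_sym mulrC.
Qed.

(** Symmetrising the double sum gives
2 f L f^T = sum_(x,y) [x ~ y] (h x - h y)^2. *)
Lemma laplacian_psd (f : 'rV[R]_#|T|) : 0 <= (f *m laplacian R e *m f^T) 0 0.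
Proof.
rewrite [f]vertex_rowE laplacian_vertex_row vertex_row_dot.
set h := fun x => f 0 (enum_rank x).
pose w x y : R := (e x y)%:R.
suff: 0 <= (\sum_x (\sum_y w x y * (h x - h y)) * h x) *+ 2.
  by rewrite pmulrn_lge0.
have swap : \sum_x (\sum_y w x y * (h x - h y)) * h x
          = \sum_x \sum_y w x y * (h y - h x) * h y.
  rewrite exchange_big; apply: eq_bigr => x _; rewrite mulr_suml.
  by apply: eq_bigr => y _; rewrite /w e_sym.
rewrite mulr2n {2}swap -big_split sumr_ge0 // => x _ /=.
rewrite mulr_suml -big_split sumr_ge0 // => y _ /=.
have -> : w x y * (h x - h y) * h x + w x y * (h y - h x) * h y
  = w x y * (h x - h y) ^+ 2 by ring.
by rewrite mulr_ge0 ?sqr_ge0 ?ler0n.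
Qed.

Lemma sum_nat_rel (A : {set T}) x :
  #|[set y in A | e x y]| = (\sum_(y in A) e x y)%N.
Proof.
rewrite -sum1_card big_mkcond [RHS]big_mkcond; apply: eq_bigr => y _.
by rewrite inE; case: (y \in A) => //=; case: (e x y).
Qed.

Variable X : {set T}.

(** A cut edge {x, y} determines its end x in X and its end y in X^c, so cut edges
can be counted as ordered pairs. *)
Lemma card_edge_cut :
  #|edge_cut e X| = (\sum_(x in X) #|[set y in ~: X | e x y]|)%N.
Proof.
pose D := [set p : T * T | [&& p.1 \in X, p.2 \in ~: X & e p.1 p.2]].
have -> : edge_cut e X = [set [set p.1; p.2] | p in D].
  apply/setP => S; apply/imset2P/imsetP => [[x y xX]|[[x y]]].
    rewrite !inE => /andP[yX exy] ->; exists (x, y) => //.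
    by rewrite !inE /= xX yX.
  rewrite /D !inE /= => /and3P[xX yX exy] ->.
  by apply: (Imset2spec xX) => //; rewrite !inE yX.
rewrite card_in_imset => [|[x y] [x' y']]; last first.
  rewrite !inE /= => /and3P[xX yX _] /and3P[x'X y'X _] eqS.
  have : x \in [set x'; y'] by rewrite -eqS set21.
  have : y \in [set x'; y'] by rewrite -eqS set22.
  rewrite !inE => /orP[/eqP yx'|/eqP ->]; first by rewrite yx' x'X in yX.
  by case/orP => /eqP xx'; [rewrite xx'|rewrite -xx' xX in y'X].
under [RHS]eq_bigr do rewrite -sum1_card.
rewrite pair_big_dep /= -sum1_card; apply: eq_bigl => p.
by rewrite !inE.
Qed.

Lemma card_edge_cutC :
  #|edge_cut e X| = (\sum_(y in ~: X) #|[set x in X | e y x]|)%N.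
Proof.
rewrite card_edge_cut; under eq_bigr do rewrite sum_nat_rel.
rewrite exchange_big; apply: eq_bigr => y _; rewrite sum_nat_rel.
by apply: eq_bigr => x _; rewrite e_sym.
Qed.

(** The combination of the indicators of X and X^c that is orthogonal to the
constants, scaled so that its values on the two sides differ by n. *)
Definition cut_fun (x : T) : R := if x \in X then #|~: X|%:R else - #|X|%:R.

(** Only the neighbours on the other side contribute, each by the jump n or -n. *)
Lemma laplacian_cut_fun x :
  \sum_y (e x y)%:R * (cut_fun x - cut_fun y) =
  if x \in X then #|T|%:R * #|[set y in ~: X | e x y]|%:R
  else - (#|T|%:R * #|[set y in X | e x y]|%:R).
Proof.
have nE : #|T|%:R = #|X|%:R + #|~: X|%:R :> R by rewrite -natrD cardsC.
rewrite (bigID (mem X)) /=; case: ifP => xX.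
  rewrite big1 => [|y yX]; last by rewrite /cut_fun xX yX subrr mulr0.
  rewrite add0r sum_nat_rel natr_sum mulr_sumr.
  apply: eq_big => [y|y /negPf yX]; first by rewrite inE.
  by rewrite /cut_fun xX yX nE; ring.
rewrite [X in _ + X]big1 => [|y /negPf yX]; last first.
  by rewrite /cut_fun xX yX subrr mulr0.
rewrite addr0 sum_nat_rel natr_sum mulr_sumr -sumrN.
by apply: eq_bigr => y yX; rewrite /cut_fun xX yX nE; ring.
Qed.

Lemma sum_by_side (F : T -> R) (a b : R) :
  \sum_x F x * (if x \in X then a else b) =
  (\sum_(x in X) F x) * a + (\sum_(x in ~: X) F x) * b.
Proof.
rewrite (bigID (mem X)) /= !mulr_suml; congr (_ + _).
  by apply: eq_bigr => x ->.
by apply: eq_big => [x|x /negPf -> //]; rewrite inE.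
Qed.

Let f := vertex_row cut_fun.

Lemma cut_norm : (f *m f^T) 0 0 = #|T|%:R * (#|X|%:R * #|~: X|%:R).
Proof.
have nE : #|T|%:R = #|X|%:R + #|~: X|%:R :> R by rewrite -natrD cardsC.
rewrite vertex_row_dot sum_by_side.
have -> : \sum_(x in X) cut_fun x = #|X|%:R * #|~: X|%:R.
  by rewrite mulr_natl -sumr_const; apply: eq_bigr => x xX; rewrite /cut_fun xX.
have -> : \sum_(x in ~: X) cut_fun x = - (#|~: X|%:R * #|X|%:R).
  rewrite mulr_natl -mulNrn -sumr_const; apply: eq_bigr => x.
  by rewrite inE /cut_fun => /negPf ->.
by rewrite nE; ring.
Qed.

Lemma cut_form :
  (f *m laplacian R e *m f^T) 0 0 = #|T|%:R ^+ 2 * #|edge_cut e X|%:R.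
Proof.
have nE : #|T|%:R = #|X|%:R + #|~: X|%:R :> R by rewrite -natrD cardsC.
rewrite laplacian_vertex_row vertex_row_dot sum_by_side.
have -> : \sum_(x in X) \sum_y (e x y)%:R * (cut_fun x - cut_fun y)
        = #|T|%:R * #|edge_cut e X|%:R.
  rewrite card_edge_cut natr_sum mulr_sumr; apply: eq_bigr => x xX.
  by rewrite laplacian_cut_fun xX.
have -> : \sum_(x in ~: X) \sum_y (e x y)%:R * (cut_fun x - cut_fun y)
        = - (#|T|%:R * #|edge_cut e X|%:R).
  rewrite card_edge_cutC natr_sum mulr_sumr -sumrN; apply: eq_bigr => x.
  by rewrite inE laplacian_cut_fun => /negPf ->.
by rewrite nE; ring.
Qed.

Lemma cut_orthogonal : (f *m (vertex_row (fun=> 1))^T) 0 0 = 0.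
Proof.
rewrite vertex_row_dot.
transitivity (\sum_x (fun=> 1 : R) x *
  (if x \in X then #|~: X|%:R else - #|X|%:R) : R).
  by apply: eq_bigr => x _; rewrite mulrC.
by rewrite sum_by_side !sumr_const; ring.
Qed.

Lemma laplacian_const : vertex_row (fun=> 1) *m laplacian R e = 0.
Proof.
rewrite laplacian_vertex_row; apply/rowP => i; rewrite !mxE.
by apply: big1 => y _; rewrite subrr mulr0.
Qed.

Hypotheses (X0 : (0 < #|X|)%N) (XC0 : (0 < #|~: X|)%N).

Lemma cut_rayleigh :
  (f *m laplacian R e *m f^T) 0 0 = edge_density R e X * (f *m f^T) 0 0.
Proof.
rewrite cut_form cut_norm /edge_density.
by field; rewrite !pnatr_eq0 -!lt0n X0 XC0.
Qed.

Lemma cut_norm_gt0 : 0 < (f *m f^T) 0 0.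
Proof. by rewrite cut_norm !mulr_gt0 ?ltr0n // -(cardsC X) addn_gt0 X0. Qed.

Lemma edge_density_le :
  edge_density R e X <= laplacian_mu R e 1 /\
  (edge_density R e X = laplacian_mu R e 1 ->
   f *m laplacian R e = edge_density R e X *: f).
Proof.
have [le_form eq_form] := rayleigh_max f laplacian_tr.
move: le_form eq_form; rewrite cut_rayleigh ler_pM2r ?cut_norm_gt0 // => le eq.
by split=> // rhoE; rewrite rhoE in eq *; apply: eq.
Qed.

Lemma edge_density_ge :
  algebraic_connectivity R e <= edge_density R e X /\
  (edge_density R e X = algebraic_connectivity R e ->
   f *m laplacian R e = edge_density R e X *: f).
Proof.
have n_gt1 : (1 < #|T|)%N by rewrite -(cardsC X); lia.
have one0 : vertex_row (fun=> 1) != 0.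
  apply/eqP => /rowP/(_ (Ordinal (ltnW n_gt1)))/eqP.
  by rewrite !mxE oner_eq0.
have [le_form eq_form] := rayleigh_second n_gt1 laplacian_tr laplacian_psd
  one0 laplacian_const cut_orthogonal.
move: le_form eq_form; rewrite cut_rayleigh ler_pM2r ?cut_norm_gt0 // => le eq.
by split=> // rhoE; rewrite rhoE in eq *; apply: eq.
Qed.

(** At a vertex of X the eigenvector equation reads n * (number of neighbours in
X^c) = c |X^c|, whose right side does not depend on the vertex; similarly on
X^c.  The last identity counts the cut edges from both sides. *)
Lemma cut_eigenvector_biregular c : f *m laplacian R e = c *: f ->
  exists s t : int,
    [/\ forall x, x \in X -> #|[set y in ~: X | e x y]|%:Z = s,
        forall y, y \in ~: X -> #|[set x in X | e y x]|%:Z = t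
      & s * #|X|%:Z = t * #|~: X|%:Z].
Proof.
rewrite laplacian_vertex_row => /rowP eig.
have n0 : #|T|%:R != 0 :> R by rewrite pnatr_eq0 -lt0n -(cardsC X) addn_gt0 X0.
have eigx x : (if x \in X then #|T|%:R * #|[set y in ~: X | e x y]|%:R
    else - (#|T|%:R * #|[set y in X | e x y]|%:R)) = c * cut_fun x.
  by have := eig (enum_rank x); rewrite !mxE enum_rankK laplacian_cut_fun.
have [/card_gt0P[x0 x0X] /card_gt0P[y0 y0X]] := (X0, XC0).
have outE x : x \in X -> #|[set y in ~: X | e x y]| = #|[set y in ~: X | e x0 y]|.
  move=> xX; apply/eqP; rewrite -(eqr_nat R) -(inj_eq (mulfI n0)).
  by have := eigx x; have := eigx x0; rewrite /cut_fun x0X xX => -> ->.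
have inXE y : y \in ~: X -> #|[set x in X | e y x]| = #|[set x in X | e y0 x]|.
  move=> yX; apply/eqP; rewrite -(eqr_nat R) -(inj_eq (mulfI n0)) -eqr_opp.
  have := eigx y; have := eigx y0; move: yX y0X; rewrite /cut_fun !inE.
  by move=> /negPf -> /negPf -> -> ->.
exists #|[set y in ~: X | e x0 y]|%:Z, #|[set x in X | e y0 x]|%:Z; split.
- by move=> x /outE ->.
- by move=> y /inXE ->.
have := card_edge_cutC; rewrite card_edge_cut (eq_bigr _ outE) (eq_bigr _ inXE).
by rewrite !sum_nat_const -!PoszM => eqE; rewrite mulnC eqE mulnC.
Qed.

End CutVector.

Theorem corollary3 (R : realType) (T : finType) (e : rel T)
    (e_sym : symmetric e) (e_irr : irreflexive e) (e_conn : connected_graph e)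
    (X : {set T}) (X_neq0 : X != set0) (X_proper : X \proper [set: T])
    (phi : R)
    (phi_ge : algebraic_connectivity R e <= phi)
    (phi_le : phi <= laplacian_mu R e 1) :
  `|phi - edge_density R e X| <= laplacian_spread R e /\
  (laplacian_spread R e = `|phi - edge_density R e X| ->
     (exists s t : int,
        [/\ forall x, x \in X -> #|[set y in ~: X | e x y]|%:Z = s,
            forall y, y \in ~: X -> #|[set x in X | e y x]|%:Z = t
          & s * #|X|%:Z = t * #|~: X|%:Z]) /\
     [:: edge_density R e X; phi]
       =i [:: laplacian_mu R e 1; algebraic_connectivity R e]).
Proof.
have X0 : (0 < #|X|)%N by rewrite card_gt0.
have XC0 : (0 < #|~: X|)%N.
  by rewrite card_gt0 -setTD setD_eq0; case/andP: X_proper.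
have [rho_le max_eig] := edge_density_le R e_sym X0 XC0.
have [rho_ge min_eig] := edge_density_ge R e_sym X0 XC0.
rewrite /laplacian_spread.
set mu := laplacian_mu R e 1 in phi_le rho_le max_eig *.
set a := algebraic_connectivity R e in phi_ge rho_ge min_eig *.
set rho := edge_density R e X in rho_le rho_ge max_eig min_eig *.
split=> [|spreadE]; first by rewrite ler_norml; apply/andP; split; lra.
have extremes : rho = mu /\ phi = a \/ rho = a /\ phi = mu.
  move: spreadE; case: (lerP rho phi) => rho_phi spreadE.
    by right; split; lra.
  by left; split; lra.
case: extremes => -[rhoE ->].
  have eig := max_eig rhoE; split; last by rewrite rhoE.
  exact: cut_eigenvector_biregular eig.
have eig := min_eig rhoE; split; last by move=> x; rewrite rhoE !inE orbC.
exact: cut_eigenvector_biregular eig.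
Qed.
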